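(* Let $n\in\mathbb{N}$. (i) For $1\le i\le j\le n$, $$P_n^{\text{park}}\left(i\text{ is a left-to-right maximum and }\sigma_i=j\right)=\binom{j-1}{i-1}i^{i-1}(n-i+1)^{j-i-1}\left(i(n-j)(n+1)^{-j}+(n+1)^{1-j}\right).$$ (ii) $$E_n^{\text{park}}X_n^{\text{LR-max}}=\sum_{j=1}^n\sum_{i=1}^j\binom{j-1}{i-1}i^{i-1}(n-i+1)^{j-i-1}\left(i(n-j)(n+1)^{-j}+(n+1)^{1-j}\right).$$
   Context: $[n]=\{1,\dots,n\}$ and $S_n$ is the set of permutations $\sigma=\sigma_1\cdots\sigma_n$ of $[n]$. Parking: cars $1,\dots,n$ arrive in this order on a one-way street with spaces $1,\dots,n$; given a sequence $\pi=(\pi_1,\dots,\pi_n)\in[n]^n$ of preferred spaces, car $i$ parks in space $\pi_i$ if it is free, and otherwise in the first free space with number greater than $\pi_i$, if one exists (if none exists the car exits the street). $\pi$ is a parking function on $[n]$ if all $n$ cars are able to park; $\mathcal{P}_n$ is the set of parking functions on $[n]$. The map $T_n:\mathcal{P}_n\to S_n$ is $T_n(\pi)=\sigma$, where $\sigma_j$ is the number of the car that parked in space $j$, $j\in[n]$. The probability measure $P_n^{\text{park}}$ on $S_n$ is $P_n^{\text{park}}(\sigma)=|T_n^{-1}(\{\sigma\})|/|\mathcal{P}_n|$, and $E_n^{\text{park}}$ is the corresponding expectation. A position $i\in[n]$ is a left-to-right maximum for $\sigma\in S_n$ if $\sigma_i>\sigma_k$ for all $k\in[i-1]$. $X_n^{\text{LR-max}}(\sigma)$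 is the total number of left-to-right maxima in $\sigma$. *)

(* Defs.v *)
From mathcomp Require Import all_boot all_order all_algebra all_fingroup.

Set Implicit Arguments.
Unset Strict Implicit.
Unset Printing Implicit Defensive.

Import GRing.Theory.
Local Open Scope ring_scope.

(* Cars, parking spaces and positions are elements of 'I_n, so the element
   numbered k (1 <= k <= n) in the 1-based mathematical convention is the
   ordinal of value k - 1.  Plain MathComp; probabilities take values in rat. *)

Section Parking.
Variable n : nat.

Definition preferences := {ffun 'I_n -> 'I_n}.

(* [st s = Some c] when space [s] is occupied by car [c]. *)
Definition street := {ffun 'I_n -> option 'I_n}.

Definition empty_street : street := [ffun=> None].

Definition is_free (st : street) (s : 'I_n) : bool := st s == None.

(* [None] when the car has to exit the street; [enum 'I_n] is increasing, so
   the head of the filtered sequence is the first free space beyond [p]. *)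
Definition assigned_space (st : street) (p : 'I_n) : option 'I_n :=
  if is_free st p then Some p
  else ohead [seq s : 'I_n <- enum 'I_n | (p < s)%N && is_free st s].

Definition park_car (pi : preferences) (st : street) (c : 'I_n) : street :=
  if assigned_space st (pi c) is Some s
  then [ffun s' => if s' == s then Some c else st s']
  else st.

Definition final_street (pi : preferences) : street :=
  foldl (park_car pi) empty_street (enum 'I_n).

Definition all_parked (pi : preferences) : bool :=
  [forall c, [exists s, final_street pi s == Some c]].

Definition parking_function := {p : preferences | all_parked p}.

Lemma car_parked (pi : parking_function) (c : 'I_n) :
  exists s, final_street (val pi) s == Some c.
Proof. exact/existsP/(forallP (valP pi)). Qed.

Definition space_of_car (pi : parking_function) (c : 'I_n) : 'I_n :=
  xchoose (car_parked pi c).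

Lemma space_of_carP (pi : parking_function) (c : 'I_n) :
  final_street (val pi) (space_of_car pi c) = Some c.
Proof. exact/eqP/(xchooseP (car_parked pi c)). Qed.

Lemma space_of_car_inj (pi : parking_function) : injective (space_of_car pi).
Proof.
move=> c d eq_cd; apply: Some_inj.
by rewrite -(space_of_carP pi c) -(space_of_carP pi d) eq_cd.
Qed.

(* The map T_n; see [park_permE] for its defining property. *)
Definition park_perm (pi : parking_function) : 'S_n :=
  ((perm (@space_of_car_inj pi))^-1)%g.

Lemma park_permE (pi : parking_function) (j : 'I_n) :
  final_street (val pi) j = Some (park_perm pi j).
Proof.
rewrite -[in LHS](permKV (perm (@space_of_car_inj pi)) j).
by rewrite [in LHS]permE space_of_carP.
Qed.

Definition park_mass (sigma : 'S_n) : rat :=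
  #|park_perm @^-1: [set sigma]|%:R / #|{: parking_function}|%:R.

Definition park_prob (A : {set 'S_n}) : rat := \sum_(sigma in A) park_mass sigma.

Definition park_expect (X : 'S_n -> rat) : rat :=
  \sum_(sigma : 'S_n) X sigma * park_mass sigma.

Definition lr_max (sigma : 'S_n) (i : 'I_n) : bool :=
  [forall k : 'I_n, (k < i)%N ==> (sigma k < sigma i)%N].

Definition num_lr_max (sigma : 'S_n) : nat := #|[set i | lr_max sigma i]|.

End Parking.

(* Here [n], [i], [j] are the 1-based quantities.  The exponents
   [j - i - 1] and [1 - j] are integers and may be negative; the base
   [n - i + 1] is at least 1 when [i <= n]. *)
Definition lr_max_formula (n i j : nat) : rat :=
  'C(j - 1, i - 1)%:R * i%:R ^+ (i - 1)
  * (n%:R - i%:R + 1) ^ (j%:Z - i%:Z - 1)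
  * (i%:R * (n%:R - j%:R) * (n%:R + 1) ^ (- j%:Z)
     + (n%:R + 1) ^ (1 - j%:Z)).

(* Main.v *)
Require Import Defs.
From mathcomp Require Import all_boot all_order all_algebra all_fingroup.
From mathcomp Require Import zify ring.

Set Implicit Arguments.
Unset Strict Implicit.
Unset Printing Implicit Defensive.

Import GRing.Theory Num.Theory.
Local Open Scope ring_scope.

(** Number cars and spaces from 0.  Car [j] is a left-to-right maximum at space [i]
    exactly when, at the moment it arrives, the spaces before [i] are occupied,
    space [i] is free, and [j] prefers one of the spaces up to [i]
    ([lr_max_record]).  The state of the street at that moment is read off the
    preferences of the earlier cars ([filled_before]): exactly [i] of them prefer a
    space before [i], none prefers [i], and those [i] cars form a parking function
    on the spaces before [i].  Likewise, all cars park in the end if and only if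
    every final segment of the street is preferred by at most as many cars as it
    has spaces ([all_parked_packs]).

    Fix the set [S] of the [i] earlier cars that prefer a space before [i], and the
    set [K] of the later cars that prefer a space up to [i].  The condition then
    splits into independent ones ([record_split]): the cars of [S] form a parking
    function on [i] spaces, which happens in [(i + 1) ^ (i - 1)] ways; car [j] and
    each car of [K] have [i + 1] choices; and the [m - #|K|] other cars must park
    on the [m = n - i - 1] spaces after [i], which happens in
    [(#|K| + 1) * (m + 1) ^ (m - #|K| - 1)] ways.  The last factor and the first one
    are instances of the number [(m + 1 - r) * (m + 1) ^ (r - 1)] of preferences
    with which [r] cars park on [m] spaces ([freq_packs]), which also gives the
    total number [(n + 1) ^ (n - 1)] of parking functions.

    The sets [S] contribute ['C(j, i)] equal terms, and the sum over [K] is, up to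
    normalisation, the mean of [1 + X] for a binomial variable [X]
    ([sum_subsets_affine]); this mean is the two-term factor of the formula.  The
    expectation follows by linearity, as a record at position [i] has value at
    least [i] ([lr_max_le]). *)

(** * Sums over subsets *)

Lemma sum_over_subsets (R : pzRingType) (T : finType) (A : {set T}) (F : nat -> R) :
  \sum_(B : {set T} | B \subset A) F #|B|
  = \sum_(k < #|A|.+1) F k *+ 'C(#|A|, k).
Proof.
rewrite (partition_big (fun B : {set T} => inord #|B| : 'I_#|A|.+1) xpredT) //.
apply: eq_bigr => k _; rewrite -cards_draws -sumr_const.
apply: eq_big => [B | B /andP[sBA /eqP <-]]; last first.
  by rewrite inordK // ltnS subset_leq_card.
rewrite !inE; case: (boolP (B \subset A)) => //= sBA.
by rewrite -(inj_eq val_inj) /= inordK // ltnS subset_leq_card.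
Qed.

(** Up to normalisation, the mean of a binomial variable: absorb the factor [k] by
    [k * 'C(r, k) = r * 'C(r - 1, k - 1)]. *)
Lemma binomial_mean (R : comPzRingType) (x y : R) (r : nat) :
  (\sum_(k < r.+1) (x ^+ k * y ^+ (r - k) * k%:R) *+ 'C(r, k)) * (x + y)
  = r%:R * x * (x + y) ^+ r.
Proof.
case: r => [|r]; first by rewrite big_ord1 /= mulr0 mul0rn !mul0r.
rewrite big_ord_recl /= mulr0 mul0rn add0r exprSr mulrA; congr (_ * _).
rewrite addrC exprDn mulr_sumr; apply: eq_bigr => k _.
rewrite /bump leq0n add1n subSS exprS -[in LHS]mulr_natr -[in RHS]mulr_natr.
have /(congr1 (fun m => m%:R : R)) := mul_bin_diag r.+1 k; rewrite /= !natrM => E.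
transitivity (x * x ^+ k * y ^+ (r - k) * (k.+1%:R * 'C(r.+1, k.+1)%:R)); first by ring.
by rewrite -E; ring.
Qed.

(** Both counts below classify cars by the set [B] of those that prefer the low
    spaces, with [x] choices for a car of [B], [y] for the others, and a remaining
    factor affine in the size of [B]. *)
Lemma sum_subsets_affine (R : comPzRingType) (T : finType) (A : {set T}) (x y u : R) :
  (\sum_(B : {set T} | B \subset A)
      x ^+ #|B| * y ^+ (#|A| - #|B|) * (u + #|B|%:R)) * (x + y)
  = (x + y) ^+ #|A| * (u * (x + y) + #|A|%:R * x).
Proof.
rewrite (sum_over_subsets _ (fun k => x ^+ k * y ^+ (#|A| - k) * (u + k%:R))).
under eq_bigr => k _ do rewrite mulrDr mulrnDl.
rewrite big_split mulrDl binomial_mean.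
rewrite (_ : \sum_(i < _) _ = u * (x + y) ^+ #|A|); first by ring.
rewrite [x + y]addrC exprDn mulr_sumr; apply: eq_bigr => k _.
by rewrite -mulrnAr -[in LHS]mulr_natr -[in RHS]mulr_natr; ring.
Qed.

(** * Parking preferences under the uniform distribution *)

Section Frequency.
Variables (C : finType) (n : nat).
Local Notation choices := {ffun C -> 'I_n}.
Implicit Types (A B : {set C}) (P Q : pred choices) (f g : choices).

(** Counts of preferences are normalised by the total number: then conditions on
    disjoint sets of cars multiply, with no bookkeeping of the other cars. *)
Definition freq P : rat := #|[pred f | P f]|%:R / #|{: choices}|%:R.

Lemma eq_freq P Q : P =1 Q -> freq P = freq Q.
Proof. by move=> eqPQ; rewrite /freq (eq_card (B := [pred f | Q f])). Qed.

Lemma freq_partition (J : finType) (g : choices -> J) (D : pred J) P :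
  (forall f, P f -> D (g f)) ->
  freq P = \sum_(x | D x) freq [pred f | P f && (g f == x)].
Proof.
move=> sPD; rewrite /freq -mulr_suml -natr_sum; congr (_%:R / _).
rewrite -sum1_card (partition_big g D) //; apply: eq_bigr => x _.
by rewrite sum1_card.
Qed.

Definition determined_by A P :=
  forall f g, {in A, f =1 g} -> P f = P g.

(** Exchanging the values outside [A] of two assignments [f], [g] is an involution
    on pairs; it carries the pairs where [f] satisfies [P] and [g] satisfies [Q] to
    the pairs whose first component satisfies both. *)
Lemma freq_indep A B P Q :
  determined_by A P -> determined_by B Q -> [disjoint A & B] ->
  freq (predI P Q) = freq P * freq Q.
Proof.
move=> detP detQ disAB.
pose mix (fg : choices * choices) : choices := [ffun c => if c \in A then fg.1 c else fg.2 c].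
pose swap fg := (mix fg, mix (fg.2, fg.1)).
have swapK : involutive swap.
  case=> f g; rewrite /swap /mix /=; congr pair; apply/ffunP => c;
    by rewrite !ffunE; case: (c \in A).
have cardPQ : (#|[pred f | P f]| * #|[pred f | Q f]|
               = #|[pred f | P f && Q f]| * #|{: choices}|)%N.
  rewrite -!cardX -(card_image (inv_inj swapK)); apply: eq_card => fg.
  rewrite -[fg]swapK (mem_image (inv_inj swapK)) swapK; case: fg => f g.
  rewrite !inE /= andbT; congr (_ && _); [apply: detP|apply: detQ] => c cS.
    by rewrite ffunE cS.
  by rewrite ffunE (disjointFl disAB cS).
rewrite /freq.
have [/eqP C0|C_neq0] := boolP (#|{: choices}| == 0%N).
  by rewrite C0 invr0 !mulr0.
rewrite mulrACA -natrM cardPQ natrM mulrA mulfK ?pnatr_eq0 //.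
Qed.

Lemma determined_byI A B P Q :
  determined_by A P -> determined_by B Q -> determined_by (A :|: B) (predI P Q).
Proof.
move=> detP detQ f g eq_fg; congr (_ && _); [apply: detP|apply: detQ] => c cS.
  by apply: eq_fg; rewrite inE cS.
by apply: eq_fg; rewrite inE cS orbT.
Qed.

Lemma freq_all_in A (V : pred 'I_n) :
  (0 < n)%N ->
  freq [pred f : choices | [forall c in A, V (f c)]] = (#|V|%:R / n%:R) ^+ #|A|.
Proof.
move=> n_gt0.
have n0 : n%:R != 0 :> rat by rewrite pnatr_eq0 -lt0n.
rewrite /freq card_ffun card_ord.
have -> : #|[pred f : choices | [forall c in A, V (f c)]]|
        = (#|V| ^ #|A| * n ^ #|~: A|)%N.
  have -> : #|[pred f : choices | [forall c in A, V (f c)]]|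
        = #|(family (fun c => if c \in A then V else predT) : pred choices)|.
    apply: eq_card => f; rewrite !inE; apply: eq_forallb => c.
    rewrite -[RHS]/((if c \in A then V else predT) (f c)).
    by case: (c \in A).
  rewrite card_family foldrE big_map big_enum /= (bigID [in A]) /=.
  congr (_ * _)%N.
    by rewrite -prod_nat_const; apply: eq_bigr => c ->.
  rewrite -[n in (n ^ _)%N]card_ord -prod_nat_const.
  by apply: eq_big => [c|c /negbTE->//]; rewrite inE.
rewrite -(cardsC A) expnD !natrM !natrX expr_div_n.
by rewrite invfM mulrACA divff ?mulr1 // expf_neq0.
Qed.

(** The condition under which the cars of [A], arriving alone, all park in the block
    of spaces from [lo] (included) to [hi] (excluded).  Expressed by counting, it
    ignores the order of arrival; some spaces of the block may stay free. *)
Definition packs A (lo hi : nat) : pred choices := fun f =>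
  [forall c in A, (lo <= f c < hi)%N]
  && [forall t : 'I_n, (lo <= t)%N ==> (#|[set c in A | (t <= f c)%N]| <= hi - t)%N].

Lemma packsP A lo hi f :
  reflect ((forall c, c \in A -> (lo <= f c < hi)%N)
           /\ (forall t, (lo <= t)%N -> (#|[set c in A | (t <= f c)%N]| <= hi - t)%N))
          (packs A lo hi f).
Proof.
apply: (iffP andP) => [[/forall_inP inA /forall_inP tailA]|[inA tailA]]; last first.
  by split; apply/forall_inP => // t; apply: tailA.
split=> // t lo_t; have [t_lt|t_ge] := ltnP t n; first exact: (tailA (Ordinal t_lt)).
rewrite (_ : [set _ in _ | _] = set0) ?cards0 //.
by apply/setP=> c; rewrite !inE leqNgt (leq_trans (ltn_ord _) t_ge) andbF.
Qed.

Lemma determined_by_packs A lo hi : determined_by A (packs A lo hi).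
Proof.
move=> f g eq_fg; congr (_ && _).
  by apply: eq_forallb => c; case: (boolP (c \in A)) => //= cA; rewrite eq_fg.
apply: eq_forallb => t; congr (_ ==> (_ <= _)%N); apply: eq_card => c.
by rewrite !inE; case: (boolP (c \in A)) => //= cA; rewrite eq_fg.
Qed.

Lemma determined_by_all_in A (V : pred 'I_n) :
  determined_by A [pred f : choices | [forall c in A, V (f c)]].
Proof.
move=> f g eq_fg; apply: eq_forallb => c.
by case: (boolP (c \in A)) => //= cA; rewrite eq_fg.
Qed.

(** Discarding the cars that prefer the first space of the block only loses the
    constraint at [t = lo], which says that the block has room for all of [A]. *)
Lemma packs_first_space A lo hi f B :
  (lo < hi)%N -> (#|A| <= hi - lo)%N -> B \subset A ->
  packs A lo hi f && ([set c in A | f c == lo :> nat] == B)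
  = [forall c in B, f c == lo :> nat] && packs (A :\: B) lo.+1 hi f.
Proof.
move=> lo_hi leA sBA; apply/andP/andP => -[].
  move=> /packsP[inA tailA] /eqP defB; split.
    by apply/forall_inP => c; rewrite -defB inE => /andP[].
  apply/packsP; split=> [c|t lo_t].
    rewrite -defB !inE; case: (boolP (c \in A)); last by rewrite andbF.
    by move=> /inA; lia.
  apply: leq_trans (tailA t (ltnW lo_t)); apply/subset_leq_card/subsetP => c.
  by rewrite !inE => /andP[/andP[_ ->]].
move=> eqB /packsP[inAB tailAB].
have notB c : c \in A -> c \notin B -> (lo < f c < hi)%N.
  by move=> cA cB; apply: inAB; rewrite inE cB.
split.
  apply/packsP; split=> [c cA | t].
    have [/(forall_inP eqB)/eqP-> |cB] := boolP (c \in B); first by rewrite leqnn.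
    by have := notB c cA cB; lia.
  rewrite leq_eqVlt => /predU1P[<-|lo_t].
    apply: leq_trans leA; apply/subset_leq_card/subsetP => c.
    by rewrite inE => /andP[].
  apply: leq_trans (tailAB t lo_t); apply/subset_leq_card/subsetP => c.
  rewrite !inE => /andP[cA t_c]; rewrite cA t_c !andbT.
  by apply/negP => /(forall_inP eqB)/eqP fc; move: lo_t; rewrite ltnNge -fc t_c.
apply/eqP/setP=> c; rewrite inE; apply/andP/idP => [[cA fc]|cB].
  by apply: contraLR fc => /(notB c cA)/andP[]; rewrite neq_ltn => ->; rewrite orbT.
by rewrite (subsetP sBA c cB) (forall_inP eqB).
Qed.

Lemma packs_overfull A lo hi f : (hi - lo < #|A|)%N -> packs A lo hi f = false.
Proof.
move=> gtA; apply/packsP => -[inA tailA].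
have := tailA lo (leqnn lo); rewrite leqNgt (leq_trans gtA) //.
by apply/subset_leq_card/subsetP => c cA; rewrite inE cA; case/andP: (inA c cA).
Qed.

Lemma freq_pred0 P : P =1 xpred0 -> freq P = 0.
Proof. by move=> P0; rewrite /freq eq_card0 ?mul0r. Qed.

(** The classical count [(m + 1 - r) * (m + 1) ^ (r - 1)] of preferences with which
    [r] cars park on [m] spaces, by induction on [m]: classify by the set of
    cars that prefer the first space.  The case [r = m + 1], where both sides vanish,
    is included because the induction step from [m + 1] cars on [m + 1] spaces meets
    it when nobody prefers the first space. *)
Lemma freq_packs A lo m :
  (0 < n)%N -> (lo + m <= n)%N -> (#|A| <= m.+1)%N ->
  freq (packs A lo (lo + m))
  = (m.+1%:R - #|A|%:R) / m.+1%:R * (m.+1%:R / n%:R) ^+ #|A|.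
Proof.
move=> n_gt0.
have n0 : n%:R != 0 :> rat by rewrite pnatr_eq0 -lt0n.
elim: m A lo => [|m IH] A lo le_n leA.
  move: leA; rewrite leq_eqVlt => /predU1P[A1|].
    rewrite A1 subrr !mul0r freq_pred0 // => f.
    by rewrite packs_overfull // A1 addn0 subnn.
  rewrite ltnS leqn0 cards_eq0 => /eqP A0.
  rewrite A0 cards0 expr0 mulr1 subr0 divr1 /freq.
  rewrite (eq_card (B := predT)); last first.
    move=> f; rewrite !inE; apply/packsP; split=> [c|t _]; first by rewrite inE.
    by rewrite (_ : [set _ in _ | _] = set0) ?cards0 //; apply/setP=> c; rewrite !inE.
  by rewrite divff // card_ffun card_ord pnatr_eq0 expn_eq0 negb_and -lt0n n_gt0.
move: leA; rewrite leq_eqVlt => /predU1P[A1|].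
  rewrite A1 subrr !mul0r freq_pred0 // => f.
  by rewrite packs_overfull // A1; lia.
rewrite ltnS => leA.
rewrite (freq_partition (g := fun f => [set c in A | f c == lo :> nat])
          (D := fun B => B \subset A)); last first.
  by move=> f _; apply/subsetP=> c; rewrite inE => /andP[].
have lo_n : (lo < n)%N by lia.
have M0 : m.+1%:R != 0 :> rat by rewrite pnatr_eq0.
have M1 : 1 + m.+1%:R != 0 :> rat by rewrite -(natrD _ 1) pnatr_eq0.
transitivity (\sum_(B : {set C} | B \subset A)
   (1 ^+ #|B| * m.+1%:R ^+ (#|A| - #|B|) * (m.+1%:R - #|A|%:R + #|B|%:R) / m.+1%:R / n%:R ^+ #|A|
     : rat)).
  apply: eq_bigr => B sBA.
  rewrite (eq_freq (Q := predI [pred f : choices | [forall c in B, f c == Ordinal lo_n]]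
       (packs (A :\: B) lo.+1 (lo.+1 + m)))); last first.
    by move=> f /=; rewrite packs_first_space ?addSnnS //; lia.
  have cB : #|A :\: B| = (#|A| - #|B|)%N by rewrite cardsD (setIidPr sBA).
  have leB := subset_leq_card sBA.
  (* The cars outside [B] play the same game on the block without its first space. *)
  rewrite (freq_indep (A := B) (B := A :\: B)); first last.
  - by rewrite disjoint_sym disjoints_subset setDE subsetIr.
  - exact: determined_by_packs.
  - exact: (@determined_by_all_in _ (pred1 (Ordinal lo_n))).
  rewrite (freq_all_in B (pred1 (Ordinal lo_n))) // card1 IH ?cB; try lia.
  rewrite natrB // -[in RHS](subnK leB) exprD !expr_div_n expr1n subnK //.
  have nB : n%:R ^+ #|B| != 0 :> rat by rewrite expf_neq0.
  have nAB : n%:R ^+ (#|A| - #|B|) != 0 :> rat by rewrite expf_neq0.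
  move: (m.+1%:R) M0 => M M0.
  by field; rewrite nB nAB M0.
rewrite -!mulr_suml.
have := sum_subsets_affine A 1 m.+1%:R (m.+1%:R - #|A|%:R : rat).
move/(canRL (mulfK M1)) => ->.
rewrite expr_div_n -[m.+2]add1n natrD.
have nA : n%:R ^+ #|A| != 0 :> rat by rewrite expf_neq0.
move: (m.+1%:R) M0 M1 => M M0 M1.
by field; rewrite nA M0 M1.
Qed.
End Frequency.

(** * The parking process *)

Section Process.
Variable n : nat.
Implicit Types (pi : preferences n) (st : street n) (l : seq 'I_n) (s u c : 'I_n).

Variant assigned_space_spec st (p : 'I_n) : option 'I_n -> Prop :=
| Assigned s of (p <= s)%N & is_free st s
    & (forall u, (p <= u < s)%N -> ~~ is_free st u) :
    assigned_space_spec st p (Some s)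
| Exits of (forall u, (p <= u)%N -> ~~ is_free st u) :
    assigned_space_spec st p None.

Lemma assigned_spaceP st p : assigned_space_spec st p (assigned_space st p).
Proof.
rewrite /assigned_space; have [p_free|p_occ] := boolP (is_free st p).
  by constructor=> // u; lia.
pose r := [seq s : 'I_n <- enum 'I_n | (p < s)%N && is_free st s].
have r_sorted : sorted (relpre val ltn) r.
  apply: sorted_filter; first by move=> x y z; apply: ltn_trans.
  by rewrite -sorted_map val_enum_ord iota_ltn_sorted.
have mem_r u : (u \in r) = (p < u)%N && is_free st u.
  by rewrite mem_filter mem_enum andbT.
have occ_p u : (p <= u)%N -> u \notin r -> ~~ is_free st u.
  rewrite mem_r leq_eqVlt => /predU1P[/val_inj<- //|->]; exact.
rewrite -/r; case: r r_sorted mem_r occ_p => [|s r] /= r_sorted mem_r occ_p.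
  by constructor=> u /occ_p; apply.
have /andP[p_s s_free] : (p < s)%N && is_free st s by rewrite -mem_r mem_head.
constructor=> // [|u /andP[p_u u_s]]; first exact: ltnW.
apply: occ_p => //; rewrite inE negb_or neq_ltn u_s /=.
apply/negP=> /(allP (order_path_min _ r_sorted)) /=.
have tr : transitive (relpre (val : 'I_n -> nat) ltn).
  by move=> x y z; apply: ltn_trans.
by move/(_ tr); lia.
Qed.

Definition run pi l : street n := foldl (park_car pi) (empty_street n) l.

Lemma park_car_stays pi st c s d : st s = Some d -> park_car pi st c s = Some d.
Proof.
move=> st_s; rewrite /park_car; case: assigned_spaceP => // s' _ s'_free _.
by rewrite ffunE; case: eqP => // E; move: s'_free; rewrite /is_free -E st_s.
Qed.

Lemma foldl_park_stays pi st l s d :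
  st s = Some d -> foldl (park_car pi) st l s = Some d.
Proof.
by elim: l st => //= c l IH st st_s; apply/IH/park_car_stays.
Qed.

(** What is needed about a street on which the cars of [l] have arrived: a parked car
    only passed occupied spaces, a car that left found none free, and no car is in
    two spaces. *)
Definition reachable pi l st :=
  [/\ forall s c, st s = Some c ->
        [/\ c \in l, (pi c <= s)%N
          & forall u, (pi c <= u < s)%N -> ~~ is_free st u],
      forall c, c \in l ->
        (exists s, st s = Some c) \/ (forall u, (pi c <= u)%N -> ~~ is_free st u)
    & forall s s' c, st s = Some c -> st s' = Some c -> s = s'].

Lemma occupied_stays pi st c s : ~~ is_free st s -> ~~ is_free (park_car pi st c) s.
Proof.
by rewrite /is_free; case E: (st s) => [d|] // _; rewrite (park_car_stays _ _ E).
Qed.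

Lemma run_reachable pi l : uniq l -> reachable pi l (run pi l).
Proof.
elim/last_ind: l => [_|l c IH].
  by split=> [s d|d|s s' d]; rewrite ?ffunE.
rewrite rcons_uniq => /andP[c_l /IH[I1 I2 I3]].
rewrite /run -cats1 foldl_cat /= -/(run pi l); move: (run pi l) I1 I2 I3 => st I1 I2 I3.
have occ := @occupied_stays pi st c.
have occN u : (exists d, park_car pi st c u = Some d) -> ~~ is_free (park_car pi st c) u.
  by rewrite /is_free => -[d ->].
move: occ occN; rewrite /park_car; case: assigned_spaceP => [s p_s s_free occ_s|full] occ occN.
  split=> [s' d|d|s1 s2 d].
  - rewrite ffunE; case: eqP => [-> [<-]|_ /I1[d_l p_s' occ_d]].
      by split=> // [|u /occ_s/occ//]; rewrite mem_cat mem_head orbT.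
    by split=> // [|u /occ_d/occ//]; rewrite mem_cat d_l.
  - rewrite mem_cat inE => /orP[d_l|/eqP->]; last first.
      by left; exists s; rewrite ffunE eqxx.
    have [[s' st_s']|full] := I2 d d_l; last by right=> u /full/occ.
    left; exists s'; rewrite ffunE; case: eqP => // E.
    by move: s_free; rewrite /is_free -E st_s'.
  - rewrite !ffunE; case: eqP => [->|_]; case: eqP => [->//|_].
    + by move=> [<-] /I1[]; rewrite (negbTE c_l).
    + by move=> /I1[d_l _ _] [E]; move: c_l; rewrite E d_l.
    + exact: I3.
split=> // [s d /I1[d_l ? ?]|d].
  by split=> //; rewrite mem_cat d_l.
rewrite mem_cat inE => /orP[/I2//|/eqP->]; by right.
Qed.

Lemma card_ord_interval (t v : nat) : (#|[set s : 'I_n | (t <= s < v)%N]| <= v - t)%N.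
Proof.
rewrite cardE -(size_map val) -(size_iota t (v - t)).
apply: uniq_leq_size; first by rewrite map_inj_uniq ?enum_uniq //; apply: val_inj.
by move=> _ /mapP[s s_in ->]; move: s_in; rewrite mem_enum inE mem_iota /=; lia.
Qed.

Lemma card_ord_interval_eq (t v : nat) :
  (v <= n)%N -> #|[set s : 'I_n | (t <= s < v)%N]| = (v - t)%N.
Proof.
move=> v_n; apply/eqP; rewrite eqn_leq card_ord_interval /=.
rewrite -[X in (X <= _)%N](size_iota t) cardE -(size_map val).
apply: uniq_leq_size; first exact: iota_uniq.
move=> x; rewrite mem_iota => x_in.
have x_n : (x < n)%N by lia.
apply/mapP; exists (Ordinal x_n) => //; rewrite mem_enum inE /=; lia.
Qed.

(** A space holds at most one car, so the spaces of distinct cars of [A] differ. *)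
Lemma card_parked_le st (A : {set 'I_n}) (S : {set 'I_n}) :
  (forall c, c \in A -> exists2 s, s \in S & st s = Some c) -> (#|A| <= #|S|)%N.
Proof.
move=> parked; rewrite -(card_imset _ (@Some_inj _)).
apply: leq_trans _ (leq_imset_card st S); apply/subset_leq_card/subsetP.
by move=> _ /imsetP[c /parked[s sS st_s] ->]; apply/imsetP; exists s.
Qed.

Section Reached.
Variables (pi : preferences n) (l : seq 'I_n) (st : street n).
Hypothesis st_reached : reachable pi l st.

Lemma card_occupied_le (A S : {set 'I_n}) :
  (forall s, s \in S -> exists2 c, c \in A & st s = Some c) -> (#|S| <= #|A|)%N.
Proof.
case: st_reached => _ _ st_inj occ.
rewrite -(card_imset A (@Some_inj _)).
have inj : {in S &, injective st}.
  move=> s s' /occ[c _ st_s] _ /esym; rewrite st_s => st_s'; exact: st_inj st_s st_s'.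
rewrite -(card_in_imset inj); apply/subset_leq_card/subsetP => _ /imsetP[s /occ[c cA st_s] ->].
by rewrite st_s imset_f.
Qed.

(** Take the longest run of occupied spaces that ends at [u].  The space before it, if any,
    is free, so no car crossed that space: every car parked in the run also
    prefers a space of the run. *)
Lemma occupied_block u : ~~ is_free st u ->
  exists t : nat, [/\ (t <= u)%N,
    forall s, (t <= s <= u)%N -> exists2 c, c \in l & st s = Some c /\ (t <= pi c <= u)%N
   & forall p : 'I_n, (forall s, (p <= s <= u)%N -> ~~ is_free st s) -> (t <= p)%N].
Proof.
move=> u_occ.
pose P t := (t <= u)%N && [forall s : 'I_n, (t <= s <= u)%N ==> ~~ is_free st s].
have exP : exists t, P t.
  exists u; rewrite /P leqnn /=; apply/forall_inP => s /andP[us su].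
  by rewrite (_ : s = u) //; apply/val_inj/eqP; rewrite eqn_leq us su.
case: (ex_minnP exP) => t /andP[t_u /forall_inP occ] t_min.
(* Minimality of [t] gives the last claim, which in turn bounds the preferences from below. *)
exists t; have below (p : 'I_n) : (forall s, (p <= s <= u)%N -> ~~ is_free st s) -> (t <= p)%N.
  move=> occ_p; have [p_u|/ltnW] := leqP p u; last exact: leq_trans.
  by apply: t_min; rewrite /P p_u; apply/forall_inP.
split=> // s /andP[t_s s_u].
have := occ s; rewrite t_s s_u /is_free => /(_ isT).
case st_s: (st s) => [c|] // _; exists c.
  by case: st_reached => /(_ s c st_s)[].
case: st_reached => /(_ s c st_s)[_ pc_s occ_c] _ _.
split=> //; rewrite (leq_trans pc_s s_u) andbT; apply: below => v /andP[pc_v v_u].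
have [v_s|s_v] := ltnP v s; first by apply: occ_c; rewrite pc_v.
by apply: occ; rewrite v_u (leq_trans t_s).
Qed.

Lemma preferred_occupied c : c \in l -> ~~ is_free st (pi c).
Proof.
case: st_reached => I1 I2 _ /I2[[s st_s]|]; last exact.
have [_ pc_s occ] := I1 s c st_s.
move: pc_s; rewrite leq_eqVlt => /predU1P[/val_inj->|pc_s].
  by rewrite /is_free st_s.
by apply: occ; rewrite leqnn.
Qed.

(** A car that prefers a space before the free space [i] cannot have passed [i]. *)
Lemma parked_before (i : 'I_n) c : is_free st i -> c \in l -> (pi c < i)%N ->
  exists2 s : 'I_n, (pi c <= s < i)%N & st s = Some c.
Proof.
case: st_reached => I1 I2 _ i_free /I2[[s st_s]|full] pc_i; last first.
  by move: (full i (ltnW pc_i)); rewrite i_free.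
have [_ pc_s occ] := I1 s c st_s.
exists s => //; rewrite pc_s ltnNge; apply/negP; rewrite leq_eqVlt => /predU1P[E|i_s].
  by move: i_free; rewrite (val_inj E) /is_free st_s.
by have := occ i; rewrite i_s ltnW // i_free => /(_ isT).
Qed.

Definition prefers_before (i : 'I_n) := [set c in l | (pi c < i)%N].

(** The space [i] stays free exactly when the cars that prefer earlier spaces stay
    before it and nobody prefers it; the earlier spaces are then all taken if and
    only if there are [i] such cars.  For the converse direction, a car in space [i]
    would end an occupied block preferred by too many cars. *)
Lemma filled_before (i : 'I_n) :
  (is_free st i /\ forall s : 'I_n, (s < i)%N -> ~~ is_free st s)
  <-> [/\ forall c, c \in l -> pi c != i, #|prefers_before i| = i
        & packs (prefers_before i) 0 i pi].
Proof.
have [I1 I2 I3] := st_reached.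
split=> [[i_free occ]|[not_i card_i /packsP[_ tail_i]]].
  split=> [c c_l||].
  - by apply: contraTneq i_free => <-; apply: preferred_occupied.
  - apply/eqP; rewrite eqn_leq; apply/andP; split.
      rewrite -[X in (_ <= X)%N]subn0; apply: leq_trans (card_ord_interval _ _).
      apply: (card_parked_le (st := st)) => c; rewrite inE => /andP[c_l pc_i].
      have [s s_in st_s] := parked_before i_free c_l pc_i.
      by exists s => //; rewrite inE; lia.
    rewrite -[X in (X <= _)%N]subn0 -card_ord_interval_eq ?(ltnW (ltn_ord i)) //.
    apply: card_occupied_le => s; rewrite inE => /= s_i; move: (occ s s_i); rewrite /is_free.
    case st_s: (st s) => [c|] // _.
    have [c_l pc_s _] := I1 s c st_s.
    by exists c => //; rewrite inE c_l (leq_ltn_trans pc_s).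
  - apply/packsP; split=> [c|t _]; first by rewrite inE => /andP[].
    apply: leq_trans (card_ord_interval _ _).
    apply: (card_parked_le (st := st)) => c; rewrite !inE => /andP[/andP[c_l pc_i] t_pc].
    have [s s_in st_s] := parked_before i_free c_l pc_i.
    exists s => //; rewrite inE; case/andP: s_in => pc_s ->.
    by rewrite (leq_trans t_pc pc_s).
have i_free : is_free st i.
  apply/negPn/negP => /occupied_block[t [t_i block _]].
  have := tail_i t (leq0n t); rewrite leqNgt => /negP; apply.
  rewrite -subSn // -card_ord_interval_eq //.
  apply: card_occupied_le => s; rewrite inE ltnS => /block[c c_l [st_s pc]].
  exists c => //; rewrite !inE c_l /=.
  by have := not_i c c_l; rewrite -val_eqE /=; lia.
split=> // s s_i; apply/negP => s_free.
have : (#|prefers_before i| <= #|[set v : 'I_n | (0 <= v < i)%N] :\ s|)%N.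
  apply: (card_parked_le (st := st)) => c; rewrite inE => /andP[c_l pc_i].
  have [v v_in st_v] := parked_before i_free c_l pc_i.
  exists v => //; rewrite !inE; apply/andP; split; last by lia.
  by apply: contraTneq s_free => <-; rewrite /is_free st_v.
have := cardsD1 s [set v : 'I_n | (0 <= v < i)%N].
rewrite card_ord_interval_eq ?(ltnW (ltn_ord i)) // inE s_i subn0 card_i; lia.
Qed.

End Reached.
End Process.

(** * Counting conditions for parking and for records *)

Section Characterisation.
Variable n : nat.
Implicit Types (pi : preferences n) (i j c s : 'I_n).

(** If a car exits, the occupied block that ends at the last space is preferred by all
    the cars parked in it and by the exiting car, one too many. *)
Lemma all_parked_packs pi : all_parked pi = packs [set: 'I_n] 0 n pi.
Proof.
have reached := run_reachable pi (enum_uniq 'I_n).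
have [I1 I2 _] := reached.
apply/forallP/packsP => [parked | [_ tail_pi] c].
  split=> [c _|t _]; first exact: ltn_ord.
  apply: leq_trans (card_ord_interval _ _ _).
  apply: (card_parked_le (st := final_street pi)) => c; rewrite !inE /= => t_pc.
  have /existsP[s /eqP st_s] := parked c; exists s => //.
  by rewrite inE ltn_ord andbT (leq_trans t_pc) //; have [] := I1 s c st_s.
have [[s st_s]|exits] := I2 c (mem_enum _ c).
  by apply/existsP; exists s; apply/eqP.
have n_gt0 : (0 < n)%N by apply: leq_ltn_trans (ltn_ord c).
have last_lt : (n.-1 < n)%N by rewrite prednK.
have last_occ : ~~ is_free (run pi (enum 'I_n)) (Ordinal last_lt).
  by apply: exits => /=; rewrite -ltnS prednK.
have [t [t_last block below]] := occupied_block reached last_occ.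
have t_c : (t <= pi c)%N by apply: below => s /andP[/exits].
case: (boolP [exists s, final_street pi s == Some c]) => // /existsPn not_c.
have := tail_pi t (leq0n t); rewrite leqNgt => /negP; case.
rewrite -(@card_ord_interval_eq n) // [X in (_ < X)%N](cardsD1 c) !inE t_c add1n ltnS.
apply: (card_occupied_le reached) => s; rewrite inE => /andP[t_s s_n].
have [|d _ [st_s pd]] := block s; first by rewrite t_s -ltnS prednK.
exists d => //; rewrite !inE; case/andP: pd => -> _; rewrite !andbT.
by apply: contraNneq (not_c s) => <-; apply/eqP.
Qed.

Lemma mem_take_enum j c : (c \in take j (enum 'I_n)) = (c < j)%N.
Proof. by rewrite in_take ?mem_enum // index_enum_ord. Qed.

Definition earlier_before pi i j := [set c : 'I_n | (c < j)%N && (pi c < i)%N].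

Definition record_at i j pi :=
  [&& #|earlier_before pi i j| == i, packs (earlier_before pi i j) 0 i pi,
      [forall c : 'I_n, (c < j)%N ==> (pi c != i)] & (pi j <= i)%N].

(** Car [j] is a record at space [i] exactly when, at its arrival, the spaces before
    [i] are occupied, [i] is free, and [j] prefers a space up to [i]. The occupied
    spaces at that moment are those whose final car has a number below [j], since
    parked cars do not move. *)
Lemma lr_max_record (pi : parking_function n) i j :
  lr_max (park_perm pi) i && (park_perm pi i == j) = record_at i j (val pi).
Proof.
have fin_perm := park_permE pi.
have uniq_l : uniq (take j (enum 'I_n)) by rewrite take_uniq ?enum_uniq.
have reached := run_reachable (val pi) uniq_l.
have finE : final_street (val pi)
    = foldl (park_car (val pi))
        (park_car (val pi) (run (val pi) (take j (enum 'I_n))) j)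
        (drop j.+1 (enum 'I_n)).
  rewrite /final_street -[in LHS](cat_take_drop j (enum 'I_n)) foldl_cat.
  by rewrite (drop_nth j) ?size_enum_ord // nth_ord_enum.
have [F1 _ _] := run_reachable (val pi) (enum_uniq 'I_n).
set l := take j (enum 'I_n) in reached finE *.
move: (run _ l) reached finE => st reached finE.
have [I1 I2 I3] := reached.
have stays s c : st s = Some c -> park_perm pi s = c.
  move=> st_s; apply: Some_inj; rewrite -fin_perm finE.
  by apply/foldl_park_stays/park_car_stays.
have occE s : is_free st s = ~~ (park_perm pi s < j)%N.
  apply/idP/idP => [s_free|].
    apply/negP; rewrite -mem_take_enum => /I2[[s' st_s']|full].
      have E := perm_inj (stays _ _ st_s').
      by move: s_free; rewrite -E /is_free st_s'.
    have [_ p_s _] := F1 s _ (fin_perm s).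
    by have := full s p_s; rewrite s_free.
  rewrite /is_free; case st_s: (st s) => [c|] //.
  by rewrite (stays s c st_s) -mem_take_enum; have [-> _ _] := I1 s c st_s.
have earlierE : earlier_before (val pi) i j = prefers_before (val pi) l i.
  by apply/setP => c; rewrite !inE mem_take_enum.
have -> : record_at i j (val pi)
   = [&& is_free st i, [forall s : 'I_n, (s < i)%N ==> ~~ is_free st s]
       & (val pi j <= i)%N].
  rewrite /record_at earlierE; have [fill1 fill2] := filled_before reached i.
  apply/and4P/and3P => [[/eqP card_i packs_i /forall_inP not_i p_i]|[i_free occ p_i]].
    have [|i_free occ] := fill2.
      by split=> // c; rewrite mem_take_enum; apply: not_i.
    by split=> //; apply/forall_inP.
  have [|not_i card_i packs_i] := fill1; first by split=> //; apply/forall_inP.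
  split=> //; first exact/eqP.
  by apply/forall_inP => c c_j; apply: not_i; rewrite mem_take_enum.
apply/andP/and3P => [[/forall_inP lr /eqP si]|[i_free /forall_inP occ p_i]].
  split; first by rewrite occE si ltnn.
    by apply/forall_inP => s /lr; rewrite occE negbK si.
  by have [] := F1 i j; rewrite -?si.
have si : park_perm pi i = j.
  apply: Some_inj; rewrite -fin_perm finE; apply: foldl_park_stays.
  rewrite /park_car; case: assigned_spaceP => [s p_s s_free occ_s|full].
    suff -> : i = s by rewrite ffunE eqxx.
    apply/val_inj/eqP; rewrite eqn_leq; apply/andP; split.
      by rewrite leqNgt; apply: contraL s_free => /occ.
    by rewrite leqNgt; apply: contraL i_free => i_s; apply: occ_s; rewrite p_i.
  by have := full i p_i; rewrite i_free.
split; last exact/eqP.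
by apply/forall_inP => s /occ; rewrite occE negbK si.
Qed.

(** The law of the outcome is the image of the uniform law on parking functions, which is
    the uniform law on all preferences conditioned on parking. *)
Lemma park_prob_freq (A : {set 'S_n}) (Q : pred (preferences n)) :
  (0 < n)%N ->
  (forall pi : parking_function n, (park_perm pi \in A) = Q (val pi)) ->
  park_prob A = freq (predI (packs [set: 'I_n] 0 n) Q) / freq (packs (n := n) [set: 'I_n] 0 n).
Proof.
move=> n_gt0 AQ.
have card_PF (R : pred (preferences n)) :
   #|[pred p : parking_function n | R (val p)]|
   = #|[pred f | packs [set: 'I_n] 0 n f && R f]|.
  rewrite -(card_image val_inj); apply: eq_card => f; rewrite !inE.
  rewrite -all_parked_packs; apply/imageP/andP => [[p]|[f_park Rf]].
    by rewrite inE => Rp ->; split=> //; apply: valP.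
  by exists (Sub f f_park); rewrite ?inE SubK.
rewrite /freq invf_div mulrA mulfVK; last first.
  by rewrite pnatr_eq0 card_ffun card_ord expn_eq0 negb_and -lt0n n_gt0.
rewrite -card_PF /park_prob /park_mass -mulr_suml -natr_sum; congr (_%:R / _%:R).
  rewrite -[RHS]sum1_card (partition_big (@park_perm n) [in A]) => [|p]; last first.
    by rewrite inE -AQ.
  apply: eq_bigr => sigma sA; rewrite sum1_card; apply: eq_card => p.
  by rewrite -[RHS]/(Q (val p) && (park_perm p == sigma)) !inE -AQ andb_idl // => /eqP ->.
rewrite -[LHS](@eq_card _ [pred p : parking_function n | predT (val p)]) //.
by rewrite card_PF; apply: eq_card => f; rewrite !inE andbT.
Qed.

End Characterisation.

(** * Counting the preferences that produce a given record *)

Section RecordCount.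
Variables (n : nat) (i j : 'I_n).
Hypothesis le_ij : (i <= j)%N.
Implicit Types (f : preferences n) (S K : {set 'I_n}).

Definition before := [set c : 'I_n | (c < j)%N].
Definition after := [set c : 'I_n | (j < c)%N].
Definition low_cars f : {set 'I_n} * {set 'I_n} :=
  ([set c in before | (f c <= i)%N], [set c in after | (f c <= i)%N]).

Definition high_cars S K := ~: (S :|: (j |: K)).

(** Once [S] and [K] are fixed, the conditions concern disjoint sets of cars: those of
    [S] fill the spaces before [i]; [j] and the cars of [K] choose freely among the
    spaces up to [i]; the remaining ones must fit into the spaces after [i].
    Everybody then parks: the cars of [K] have to drive beyond [i], and so never count
    against a final segment that starts after [i], while the segments that start at
    or before [i] are controlled by [S]. *)
Lemma record_split f S K :
  S \subset before -> #|S| = i -> K \subset after ->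
  packs [set: 'I_n] 0 n f && record_at i j f && (low_cars f == (S, K))
  = [&& packs S 0 i f, [forall c in j |: K, (f c <= i)%N]
      & packs (high_cars S K) i.+1 n f].
Proof.
move=> sS card_S sK.
have S_j c : c \in S -> (c < j)%N by move=> /(subsetP sS); rewrite inE.
have K_j c : c \in K -> (j < c)%N by move=> /(subsetP sK); rewrite inE.
apply/andP/and3P => [[/andP[/packsP[_ tail_f] rec]]|].
  case/and4P: rec => card_i packs_i /forall_inP not_i j_i /eqP[defS defK].
  have defS' : earlier_before f i j = S.
    rewrite -defS; apply/setP => c; rewrite !inE; case: (boolP (c < j)%N) => //= c_j.
    by have := not_i c c_j; rewrite -val_eqE /= ltn_neqAle => ->.
  split; first by rewrite -defS'.
    apply/forall_inP => c; rewrite !inE => /predU1P[->//|].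
    by rewrite -defK !inE => /andP[].
  apply/packsP; split=> [c|t _].
    rewrite ltn_ord andbT !inE !negb_or -defS -defK !inE -val_eqE /=.
    by case: (ltngtP c j) => //= _; rewrite ?andbT -ltnNge.
  apply: leq_trans (tail_f t (leq0n t)); apply/subset_leq_card/subsetP => c.
  by rewrite !inE => /andP[].
move=> [/packsP[in_S tail_S] /forall_inP in_jK /packsP[in_R tail_R]].
have small c : (f c <= i)%N = (c \in S) || (c \in j |: K).
  apply/idP/orP => [f_i|[/in_S /andP[_ /ltnW]//|/in_jK//]].
  apply/orP; apply: contraLR f_i; rewrite -in_setU -in_setC -ltnNge.
  by move=> /in_R/andP[].
have S_i c : c \in S -> (f c < i)%N by move/in_S/andP=> [].
have defS c : (c \in S) = (c < j)%N && (f c <= i)%N.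
  apply/idP/andP => [cS|[c_j]]; first by rewrite S_j // ltnW // S_i.
  rewrite small !inE => /or3P[//|/eqP E|/K_j]; last by rewrite ltnNge ltnW.
  by rewrite E ltnn in c_j.
have defE : earlier_before f i j = S.
  apply/setP => c; rewrite inE; apply/andP/idP => [[c_j f_i]|cS].
    by rewrite defS c_j ltnW.
  by rewrite S_j // S_i.
split; last first.
  apply/eqP; congr pair; apply/setP => c; rewrite !inE -?defS //.
  rewrite small !inE; apply/andP/idP => [[j_c]|cK].
    case/or3P=> // [/S_j|/eqP E]; first by rewrite ltnNge ltnW.
    by rewrite E ltnn in j_c.
  by rewrite cK !orbT K_j.
apply/andP; split; last first.
  rewrite /record_at defE card_S eqxx /=; apply/and3P; split.
  - exact/packsP.
  - apply/forall_inP => c c_j; apply/eqP => f_i.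
    have : c \in S by rewrite defS c_j f_i leqnn.
    by move/S_i; rewrite f_i ltnn.
  - by apply: in_jK; rewrite !inE eqxx.
apply/packsP; split=> [c _|t _]; first exact: ltn_ord.
have [t_i|i_t] := leqP t i; last first.
  apply: leq_trans (tail_R t i_t); apply/subset_leq_card/subsetP => c.
  rewrite [c \in [set _ in setT | _]]inE in_setT /= => t_f.
  rewrite inE t_f andbT in_setC in_setU -small -ltnNge.
  exact: leq_trans i_t t_f.
(* Only cars of [S] and the [n - i] cars outside [S] can prefer spaces from [t] on. *)
have sub : [set c in [set: 'I_n] | (t <= f c)%N]
    \subset [set c in S | (t <= f c)%N] :|: ~: S.
  by apply/subsetP => c; rewrite !inE /= => ->; rewrite andbT orbN.
apply: leq_trans (subset_leq_card sub) _; apply: leq_trans (leq_card_setU _ _) _.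
apply: leq_trans (leq_add (tail_S t (leq0n t)) (leqnn _)) _.
have := cardsC S; rewrite card_S card_ord.
by have := ltn_ord i; lia.
Qed.

Let m := (n - i.+1)%N.

(** With [m] spaces after [i] and [m - #|K|] cars that prefer them, the factor
    [m + 1 - (m - #|K|)] of [freq_packs] is [1 + #|K|]; this is the affine factor
    summed by [sum_subsets_affine]. *)
Lemma freq_record_split S K :
  S \subset before -> #|S| = i -> K \subset after ->
  freq [pred f | packs [set: 'I_n] 0 n f && record_at i j f && (low_cars f == (S, K))]
  = (i.+1%:R ^+ (i + #|K|) * m.+1%:R ^+ (m - #|K|) * (1 + #|K|%:R)) / m.+1%:R / n%:R ^+ n.
Proof.
move=> sS card_S sK.
have n_gt0 : (0 < n)%N by apply: leq_ltn_trans (ltn_ord i).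
rewrite (eq_freq (Q := predI (packs S 0 (0 + i))
   (predI [pred f : preferences n | [forall c in j |: K, (f c <= i)%N]]
          (packs (high_cars S K) i.+1 (i.+1 + m))))); last first.
  by move=> f; rewrite /= record_split // add0n subnKC.
have jK : j \notin K by apply/negP => /(subsetP sK); rewrite inE ltnn.
have SjK : [disjoint S & j |: K].
  rewrite disjoints_subset; apply/subsetP => c /(subsetP sS); rewrite !inE => c_j.
  rewrite negb_or neq_ltn c_j /=; apply/negP => /(subsetP sK).
  by rewrite inE ltnNge ltnW.
have card_jK : #|j |: K| = #|K|.+1 by rewrite cardsU1 jK.
have card_R : #|high_cars S K| = (m - #|K|)%N.
  have := cardsC (S :|: (j |: K)); rewrite card_ord cardsU (disjoint_setI0 SjK).
  by rewrite cards0 card_S card_jK /high_cars /m; lia.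
have le_K : (#|K| <= m)%N.
  have := cardsC (S :|: (j |: K)); rewrite card_ord cardsU (disjoint_setI0 SjK).
  by rewrite cards0 card_S card_jK /m; lia.
rewrite (freq_indep (A := S) (B := (j |: K) :|: high_cars S K)); first last.
- rewrite disjoints_subset setCU setCK.
  by apply/subsetP => c cS; rewrite !in_setI in_setC (disjointFr SjK) // inE cS.
- apply: determined_byI; last exact: determined_by_packs.
  exact: (@determined_by_all_in _ _ _ (fun s : 'I_n => s <= i)%N).
- exact: determined_by_packs.
rewrite (freq_indep (A := j |: K) (Q := packs (high_cars S K) i.+1 (i.+1 + m))
  (B := high_cars S K)); first last.
- by rewrite disjoints_subset /high_cars setCK subsetUr.
- exact: determined_by_packs.
- exact: (@determined_by_all_in _ _ _ (fun s : 'I_n => s <= i)%N).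
rewrite freq_packs ?card_S ?add0n //; last exact: ltnW.
rewrite (freq_all_in _ (fun s : 'I_n => s <= i)%N) // card_jK.
rewrite freq_packs ?card_R //; try lia; last by rewrite /m subnKC.
have -> : #|(fun s : 'I_n => s <= i)%N| = i.+1.
  rewrite -[RHS]subn0 -(@card_ord_interval_eq n 0 i.+1) //.
  by apply: eq_card => s; rewrite inE ltnS.
have n0 : n%:R != 0 :> rat by rewrite pnatr_eq0 -lt0n.
have -> : n%:R ^+ n = n%:R ^+ i * n%:R * n%:R ^+ #|K| * n%:R ^+ (m - #|K|) :> rat.
  by rewrite -exprSr -!exprD; congr (_ ^+ _); rewrite /m; have := ltn_ord i; lia.
rewrite natrB // !expr_div_n exprS [in RHS]exprD [n%:R ^+ #|K|.+1]exprS.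
have I0 : i.+1%:R != 0 :> rat by rewrite pnatr_eq0.
have M0 : m.+1%:R != 0 :> rat by rewrite pnatr_eq0.
have -> : i%:R = i.+1%:R - 1 :> rat by rewrite -addn1 natrD addrK.
have -> : m%:R = m.+1%:R - 1 :> rat by rewrite -addn1 natrD addrK.
have := expf_neq0 i n0; have := expf_neq0 #|K| n0; have := expf_neq0 (m - #|K|) n0.
move: (n%:R ^+ i) (n%:R ^+ #|K|) (n%:R ^+ (m - #|K|)) => a b c c0 b0 a0.
move: (i.+1%:R) (m.+1%:R) I0 M0 => I M I0 M0.
by field; rewrite a0 b0 c0 n0 I0 M0.
Qed.

Lemma freq_record :
  freq (predI (packs (n := n) [set: 'I_n] 0 n) (record_at i j))
  = 'C(j, i)%:R * i.+1%:R ^+ i * m.+1%:R ^+ (j - i) / m.+1%:R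
    * (n.+1%:R + (n%:R - j.+1%:R) * i.+1%:R) * n.+1%:R ^+ (n - j.+1) / n.+1%:R
    / n%:R ^+ n.
Proof.
have card_before : #|before| = j.
  rewrite -[RHS]subn0 -(@card_ord_interval_eq n 0 j); last exact: ltnW.
  by apply: eq_card => s; rewrite !inE.
have card_after : #|after| = (n - j.+1)%N.
  rewrite -(@card_ord_interval_eq n j.+1 n) //.
  by apply: eq_card => s; rewrite !inE ltn_ord andbT.
rewrite (freq_partition (g := low_cars)
   (D := fun SK => (SK.1 \subset before) && (#|SK.1| == i) && (SK.2 \subset after))).
  2:{ move=> f /andP[_ /and4P[/eqP card_i _ /forall_inP not_i _]] /=.
  apply/andP; split; last by apply/subsetP => c; rewrite inE => /andP[].
  apply/andP; split; first by apply/subsetP => c; rewrite inE => /andP[].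
  rewrite -[X in _ == X]card_i; apply/eqP/eq_card => c; rewrite !inE.
  case: (boolP (c < j)%N) => //= c_j; rewrite leq_eqVlt.
  by have := not_i c c_j; rewrite -val_eqE /= => /negbTE->. }
transitivity (\sum_(S : {set 'I_n} | (S \subset before) && (#|S| == i))
   \sum_(K : {set 'I_n} | K \subset after)
     i.+1%:R ^+ i * m.+1%:R ^+ (j - i) / m.+1%:R / n%:R ^+ n *
     (i.+1%:R ^+ #|K| * m.+1%:R ^+ (#|after| - #|K|) * (1 + #|K|%:R)) : rat).
  rewrite pair_big /=; apply: eq_bigr => -[S K] /= /andP[/andP[sS /eqP card_S] sK].
  rewrite freq_record_split // exprD.
  have le_K := subset_leq_card sK.
  have -> : (m - #|K| = (j - i) + (#|after| - #|K|))%N.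
    by rewrite /m; move: le_K le_ij (ltn_ord j); rewrite card_after; lia.
  by rewrite exprD; ring.
have card_S : #|(fun S : {set 'I_n} => (S \subset before) && (#|S| == i))| = 'C(j, i).
  by rewrite -card_before -cards_draws; apply: eq_card => S; rewrite inE.
rewrite sumr_const card_S -mulr_sumr.
have IM : i.+1%:R + m.+1%:R = n.+1%:R :> rat.
  by rewrite -natrD; congr (_%:R); rewrite /m; have := ltn_ord i; lia.
have N0 : n.+1%:R != 0 :> rat by rewrite pnatr_eq0.
have := sum_subsets_affine after i.+1%:R m.+1%:R (1 : rat).
rewrite IM => /(canRL (mulfK N0)) ->.
rewrite card_after natrB // mul1r -[LHS]mulr_natl.
ring.
Qed.

Lemma lr_max_formulaE :
  lr_max_formula n i.+1 j.+1
  = 'C(j, i)%:R * i.+1%:R ^+ i * m.+1%:R ^+ (j - i) / m.+1%:R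
    * (n.+1%:R + (n%:R - j.+1%:R) * i.+1%:R) / n.+1%:R ^+ j.+1.
Proof.
have N0 : n.+1%:R != 0 :> rat by rewrite pnatr_eq0.
have M0 : m.+1%:R != 0 :> rat by rewrite pnatr_eq0.
rewrite /lr_max_formula !subn1 /= natr1.
have -> : n%:R - i.+1%:R + 1 = m.+1%:R :> rat.
  by rewrite -natrB ?natr1 // ltn_ord.
have -> : j.+1%:Z - i.+1%:Z - 1 = (j - i)%:Z - 1 by lia.
rewrite !expfzDr // !exprN1 -!exprnP expr1 -exprnN.
move: (n.+1%:R ^- _) => X; ring.
Qed.

Lemma park_prob_record :
  park_prob [set sigma : 'S_n | lr_max sigma i && (sigma i == j)]
  = lr_max_formula n i.+1 j.+1.
Proof.
have n_gt0 : (0 < n)%N by apply: leq_ltn_trans (ltn_ord i).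
have n0 : n%:R != 0 :> rat by rewrite pnatr_eq0 -lt0n.
have N0 : n.+1%:R != 0 :> rat by rewrite pnatr_eq0.
rewrite (@park_prob_freq _ _ (record_at i j)) // => [|pi]; last first.
  by rewrite inE lr_max_record.
rewrite freq_record lr_max_formulaE.
rewrite -[X in packs _ 0 X]add0n freq_packs ?add0n ?cardsT ?card_ord //.
(* There are [n] cars on [n] spaces, so the factor [n + 1 - r] of [freq_packs] is 1. *)
rewrite -[X in X - n%:R]natr1 addrAC subrr add0r expr_div_n.
have -> : n.+1%:R ^+ n = n.+1%:R ^+ j.+1 * n.+1%:R ^+ (n - j.+1) :> rat.
  by rewrite -exprD subnKC.
have := expf_neq0 n n0; have := expf_neq0 j.+1 N0; have := expf_neq0 (n - j.+1) N0.
have M0 : m.+1%:R != 0 :> rat by rewrite pnatr_eq0.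
move: (n%:R ^+ n) (n.+1%:R ^+ j.+1) (n.+1%:R ^+ (n - j.+1)) => a b c c0 b0 a0.
move: (n.+1%:R) (m.+1%:R) N0 M0 => N M N0 M0.
by field; rewrite a0 b0 c0 N0 M0.
Qed.

End RecordCount.

(** The [i] values before position [i] are distinct and smaller than [sigma i]. *)
Lemma lr_max_le n (sigma : 'S_n) (i : 'I_n) : lr_max sigma i -> (i <= sigma i)%N.
Proof.
move=> /forall_inP lr.
rewrite -[X in (X <= _)%N]subn0 -(@card_ord_interval_eq n 0 i); last exact: ltnW.
rewrite -(card_imset _ (@perm_inj _ sigma)) -[X in (_ <= X)%N]subn0.
apply: leq_trans (@card_ord_interval n 0 (sigma i)).
apply/subset_leq_card/subsetP.
by move=> _ /imsetP[k + ->]; rewrite !inE => /lr.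
Qed.

Lemma park_expect_num_lr_max n :
  park_expect (fun sigma : 'S_n => (num_lr_max sigma)%:R)
  = \sum_(i < n) \sum_(j < n | (i <= j)%N)
      park_prob [set sigma : 'S_n | lr_max sigma i && (sigma i == j)].
Proof.
transitivity (\sum_(sigma : 'S_n) \sum_(i < n | lr_max sigma i) park_mass sigma).
  apply: eq_bigr => sigma _; rewrite sumr_const /num_lr_max mulr_natl.
  by congr (_ *+ _); apply: eq_card => i; rewrite inE.
rewrite (exchange_big_dep xpredT) //=; apply: eq_bigr => i _.
rewrite (partition_big (fun sigma : 'S_n => sigma i) (fun j : 'I_n => (i <= j)%N)) /=.
  apply: eq_bigr => j _; apply: eq_bigl => sigma.
  by rewrite inE.
by move=> sigma; apply: lr_max_le.
Qed.

Theorem theorem5 (n : nat) (hn : (0 < n)%N) :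
  (forall i j : 'I_n, (i <= j)%N ->
     park_prob [set sigma : 'S_n | lr_max sigma i && (sigma i == j)]
     = lr_max_formula n i.+1 j.+1)
  /\ park_expect (fun sigma : 'S_n => (num_lr_max sigma)%:R)
     = \sum_(1 <= j < n.+1) \sum_(1 <= i < j.+1) lr_max_formula n i j.
Proof.
split=> [i j|]; first exact: park_prob_record.
rewrite park_expect_num_lr_max (exchange_big_dep xpredT) //=.
rewrite big_add1 big_mkord; apply: eq_bigr => j _.
rewrite big_add1 big_mkord.
rewrite (big_ord_widen n (fun i => lr_max_formula n i.+1 j.+1)); last exact: ltn_ord.
by apply: eq_big => [i|i le_ij]; rewrite ?ltnS // park_prob_record.
Qed.
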